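(* Work in homotopy type theory with univalence and function extensionality. Let $A, B$ be types and $f : A \to B$ a function such that $\mathsf{ishadj}\, f$ is inhabited. Then there is an equivalence \[ \mathsf{2adj}\, f \simeq \prod_{x : A} \big(\mathsf{refl}_{\mathsf{refl}_x} = \mathsf{refl}_{\mathsf{refl}_x}\big), \] where \[ \mathsf{2adj}\, f :\equiv \sum_{g : B \to A} \ \sum_{\eta : gf \sim \mathsf{id}_A} \ \sum_{\varepsilon : fg \sim \mathsf{id}_B} \ \sum_{\tau : f[\eta] \sim \varepsilon_f} \ \sum_{\theta : \eta_g \sim g[\varepsilon]} \ \big(\mathsf{Coh}\, \eta \cdot g \llbracket \tau \rrbracket \sim \theta_f\big) \times \big(\tau_g \cdot \mathsf{Coh}\, \varepsilon \sim f \llbracket \theta \rrbracket\big) \] and $\mathsf{ishadj}\, f :\equiv \sum_{g : B \to A} \sum_{\eta : gf \sim \mathsf{id}_A} \sum_{\varepsilon : fg \sim \mathsf{id}_B} \big(f[\eta] \sim \varepsilon_f\big)$.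
   Context: Notation: for $h : X \to Y$ and a path $p : x = y$, $h[p] : hx = hy$ denotes $\mathsf{ap}_h(p)$; for 2-paths $\alpha : p = q$, $h\llbracket \alpha \rrbracket : h[p] = h[q]$ denotes the action of $h$ on 2-paths. A homotopy $H : f \sim g$ is an element of $\prod_x f x = g x$. For $H : f \sim g$ with $f,g : X \to Y$: for $k : C \to X$, $H_k : fk \sim gk$ is $\lambda c.\, H_{k c}$; for $h : Y \to C$, $h[H] : hf \sim hg$ is $\lambda x.\, h[H_x]$; for $\alpha : H \sim H'$ (i.e. $\prod_x H_x = H'_x$), $h\llbracket \alpha \rrbracket$ is $\lambda x.\, h\llbracket \alpha_x \rrbracket$. Concatenation $H \cdot H'$ is pointwise path concatenation in diagrammatic order. For maps $u : X \to Y$, $v : Y \to X$ and $H : vu \sim \mathsf{id}_X$, the homotopy $\mathsf{Coh}\, H : H_{vu} \sim v[u[H]]$ is defined pointwise: $(\mathsf{Coh}\, H)_x : H_{v(u x)} = v[u[H_x]]$ is the concatenation of the path $H_{v(ux)} = (vu)[H_x]$ given by naturality of $H$ (applied to $H_x$, cancelling $H_x$) with the functoriality path $(vu)[H_x] = v[u[H_x]]$. In the claim, $\mathsf{Coh}\,\eta$ uses $(u,v,H) = (f,g,\eta)$ and $\mathsf{Coh}\,\varepsilon$ uses $(u,v,H) = (g,f,\varepsilon)$. *)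

(* Defs.v *)
(* Plain Rocq (no library): a minimal HoTT-style setup with a Type-valued
   identity type, so that higher paths are not truncated. *)

Set Implicit Arguments.

Inductive paths {A : Type} (a : A) : A -> Type :=
  idpath : paths a a.
Arguments idpath {A a}, {A} a.

Notation "x = y" := (paths x y) : type_scope.
Notation "x = y :> A" := (@paths A x y) : type_scope.

Definition concat {A : Type} {x y z : A} (p : x = y) (q : y = z) : x = z :=
  match q in paths _ z' return x = z' with idpath => p end.
Notation "p @ q" := (concat p q) (at level 20, left associativity).

Definition inverse {A : Type} {x y : A} (p : x = y) : y = x :=
  match p in paths _ y' return y' = x with idpath => idpath end.

(** [ap h p], written h[p] in the paper. *)
Definition ap {X Y : Type} (h : X -> Y) {x y : X} (p : x = y) : h x = h y :=
  match p in paths _ y' return h x = h y' with idpath => idpath end.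

(** Action on 2-paths, written h[[alpha]] in the paper. *)
Definition ap2 {X Y : Type} (h : X -> Y) {x y : X} {p q : x = y} (alpha : p = q)
  : ap h p = ap h q := ap (ap h) alpha.

Definition homotopy {X : Type} {P : X -> Type} (f g : forall x, P x) : Type :=
  forall x, f x = g x.
Notation "f ~ g" := (homotopy f g) (at level 70).

Definition concat_1p {A : Type} {x y : A} (p : x = y) : idpath @ p = p :=
  match p in paths _ y' return idpath @ p = p with idpath => idpath end.

Definition hnat_id {X : Type} (f : X -> X) (H : forall x, f x = x)
  {a b : X} (p : a = b) : ap f p @ H b = H a @ p :=
  match p in paths _ b' return ap f p @ H b' = H a @ p with
  | idpath => concat_1p (H a)
  end.

Definition cancelR {A : Type} {x y z : A} (p q : x = y) (r : y = z)
  : p @ r = q @ r -> p = q :=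
  match r in paths _ z' return p @ r = q @ r -> p = q with
  | idpath => fun e => e
  end.

Definition ap_compose {X Y Z : Type} (u : X -> Y) (v : Y -> Z) {x y : X} (p : x = y)
  : ap (fun t => v (u t)) p = ap v (ap u p) :=
  match p in paths _ y' return ap (fun t => v (u t)) p = ap v (ap u p) with
  | idpath => idpath
  end.

(** Pointwise: the path
    H_{v(ux)} = (vu)[H_x] obtained from naturality of H applied to H_x
    (cancelling H_x), followed by functoriality (vu)[H_x] = v[u[H_x]]. *)
Definition Coh {X Y : Type} (u : X -> Y) (v : Y -> X) (H : forall x, v (u x) = x)
  : forall x, H (v (u x)) = ap v (ap u (H x)) :=
  fun x =>
    inverse (cancelR (ap (fun t => v (u t)) (H x)) (H (v (u x))) (H x)
                     (hnat_id (fun t => v (u t)) H (H x)))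
    @ ap_compose u v (H x).

Definition ishadj {A B : Type} (f : A -> B) : Type :=
  { g : B -> A &
  { eta : forall a, g (f a) = a &
  { eps : forall b, f (g b) = b &
    forall a, ap f (eta a) = eps (f a) } } }.

Definition Equiv (X Y : Type) : Type := { e : X -> Y & ishadj e }.

Definition twoadj {A B : Type} (f : A -> B) : Type :=
  { g : B -> A &
  { eta : forall a, g (f a) = a &
  { eps : forall b, f (g b) = b &
  { tau : forall a, ap f (eta a) = eps (f a) &
  { theta : forall b, eta (g b) = ap g (eps b) &
      ((forall a, Coh f g eta a @ ap2 g (tau a) = theta (f a))
     * (forall b, tau (g b) @ Coh g f eps b = ap2 f (theta b)))%type } } } } }.

Definition happly {X : Type} {P : X -> Type} {h k : forall x, P x}
  : h = k -> forall x, h x = k x :=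
  fun e x => match e in paths _ k' return h x = k' x with idpath => idpath end.

Definition Funext : Type :=
  forall (X : Type) (P : X -> Type) (h k : forall x, P x), ishadj (@happly X P h k).

(* Main.v *)
Require Import Defs.

(* Reassociated, [twoadj f] is a family over [ishadj f]. Since f is an
   equivalence, [ishadj f] is contractible (it splits into fibres of f and of
   f[-]), so [twoadj f] is the fibre over the given (g, eta, eps, tau). There the
   pairs of theta with the coherence tau_g . Coh eps = f[[theta]] form a
   contractible type, because f[[-]] is an equivalence on 2-paths. What remains
   is, for each a, the type of 3-paths Coh eta a . g[[tau a]] = theta (f a). It is
   inhabited: under f[[-]] it becomes f[[Coh eta a . g[[tau a]]]] = tau_(gfa) .
   Coh eps (f a), which follows from the naturality of tau along eta a. An
   inhabited type of 3-paths is a triple loop space, here based at a. *)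

Lemma concat_pp_p {X : Type} {x y z w : X} (p : x = y) (q : y = z) (r : z = w) :
  (p @ q) @ r = p @ (q @ r).
Proof. destruct r; exact idpath. Defined.

Lemma concat_Vp {X : Type} {x y : X} (p : x = y) : inverse p @ p = idpath.
Proof. destruct p; exact idpath. Defined.

Lemma concat_V_pp {X : Type} {x y z : X} (p : x = y) (q : y = z) :
  inverse p @ (p @ q) = q.
Proof. destruct q, p; exact idpath. Defined.

Lemma concat_p_Vp {X : Type} {x y z : X} (p : x = y) (q : x = z) :
  p @ (inverse p @ q) = q.
Proof. destruct q, p; exact idpath. Defined.

Lemma concat_conj_V {X : Type} {x y z w : X} (c : y = z) (p : x = y) (q : w = z) :
  c @ (inverse q @ (inverse (p @ (c @ inverse q)) @ p)) = idpath.
Proof. destruct p, q, c; exact idpath. Defined.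

Lemma inv_V {X : Type} {x y : X} (p : x = y) : inverse (inverse p) = p.
Proof. destruct p; exact idpath. Defined.

Lemma ap_pp {X Y : Type} (h : X -> Y) {x y z : X} (p : x = y) (q : y = z) :
  ap h (p @ q) = ap h p @ ap h q.
Proof. destruct q; exact idpath. Defined.

Lemma ap_V {X Y : Type} (h : X -> Y) {x y : X} (p : x = y) :
  ap h (inverse p) = inverse (ap h p).
Proof. destruct p; exact idpath. Defined.

Lemma ap2_pp {X Y : Type} (h : X -> Y) {x y : X} {p q r : x = y} (alpha : p = q)
  (beta : q = r) :
  ap2 h (alpha @ beta) = ap2 h alpha @ ap2 h beta.
Proof. exact (ap_pp (ap h) alpha beta). Defined.

Lemma ap2_V {X Y : Type} (h : X -> Y) {x y : X} {p q : x = y} (alpha : p = q) :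
  ap2 h (inverse alpha) = inverse (ap2 h alpha).
Proof. exact (ap_V (ap h) alpha). Defined.

Lemma ap_idmap {X : Type} {x y : X} (p : x = y) : ap (fun u => u) p = p.
Proof. destruct p; exact idpath. Defined.

Definition whiskerL {X : Type} {x y z : X} (s : x = y) {p q : y = z} (alpha : p = q)
  : s @ p = s @ q := ap (fun u => s @ u) alpha.

Definition whiskerR {X : Type} {x y z : X} {p q : x = y} (alpha : p = q) (s : y = z)
  : p @ s = q @ s := ap (fun u => u @ s) alpha.

Lemma whiskerR_pp {X : Type} {x y z : X} {p q r : x = y} (alpha : p = q) (beta : q = r)
  (s : y = z) :
  whiskerR (alpha @ beta) s = whiskerR alpha s @ whiskerR beta s.
Proof. exact (ap_pp _ alpha beta). Defined.

Lemma whiskerR_V {X : Type} {x y z : X} {p q : x = y} (alpha : p = q) (s : y = z) :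
  whiskerR (inverse alpha) s = inverse (whiskerR alpha s).
Proof. exact (ap_V _ alpha). Defined.

Lemma whiskerR_inj {X : Type} {x y z : X} {p q : x = y} (alpha beta : p = q) (s : y = z) :
  whiskerR alpha s = whiskerR beta s -> alpha = beta.
Proof.
  destruct s; intro e.
  exact (inverse (ap_idmap alpha) @ (e @ ap_idmap beta)).
Defined.

Lemma whiskerR_cancelR {X : Type} {x y z : X} (p q : x = y) (s : y = z) (e : p @ s = q @ s) :
  whiskerR (cancelR p q s e) s = e.
Proof. destruct s; exact (ap_idmap e). Defined.

Lemma ap_whiskerR {X Y : Type} (h : X -> Y) {x y z : X} {p q : x = y} (alpha : p = q)
  (s : y = z) :
  ap2 h (whiskerR alpha s)
  = ap_pp h p s @ (whiskerR (ap2 h alpha) (ap h s) @ inverse (ap_pp h q s)).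
Proof. destruct alpha, s, p; exact idpath. Defined.

Lemma concat_1p_natural {X : Type} {y z : X} {u v : y = z} (t : u = v) :
  concat_1p u @ ap (fun w => w) t = whiskerL idpath t @ concat_1p v.
Proof. destruct t; exact (inverse (concat_1p _)). Defined.

Lemma ap2_concat_1p {X Y : Type} (h : X -> Y) {x y : X} (q : x = y) :
  inverse (ap_pp h idpath q) @ ap2 h (concat_1p q) = concat_1p (ap h q).
Proof. destruct q; exact idpath. Defined.

Lemma ap2_compose {X Y Z : Type} (u : X -> Y) (v : Y -> Z) {x y : X} {p q : x = y}
  (t : p = q) :
  ap2 v (ap2 u t)
  = inverse (ap_compose u v p) @ (ap2 (fun s => v (u s)) t @ ap_compose u v q).
Proof. destruct t, p; exact idpath. Defined.

(* [Coh u v H x] is [coh_id (fun t => v (u t)) H x @ ap_compose u v (H x)]. *)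
Definition coh_id {X : Type} (r : X -> X) (H : forall x, r x = x) (x : X)
  : H (r x) = ap r (H x) :=
  inverse (cancelR (ap r (H x)) (H (r x)) (H x) (hnat_id r H (H x))).

Lemma hnat_id_coh_id {X : Type} (r : X -> X) (H : forall x, r x = x) (x : X) :
  hnat_id r H (H x) = inverse (whiskerR (coh_id r H x) (H x)).
Proof.
  unfold coh_id, whiskerR.
  rewrite ap_V, inv_V.
  exact (inverse (whiskerR_cancelR _ _ _ _)).
Defined.

Lemma whiskerR_ap2_hnat_id {X : Type} (r : X -> X) (H : forall x, r x = x) {z : X}
  (q : r z = z) (t : q = H z) :
  whiskerR (ap2 r t) q
  = whiskerL (ap r q) t @ (hnat_id r H q @ whiskerR (coh_id r H z) q).
Proof.
  rewrite <- (inv_V t). generalize (inverse t); clear t; intro t; destruct t; cbn.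
  rewrite hnat_id_coh_id, concat_Vp.
  exact idpath.
Defined.

Definition ap_compose_shift {X Y : Type} (h : X -> Y) (k : Y -> X) {x y : X} (p : x = y)
  : ap h (ap (fun t => k (h t)) p) = ap (fun t => h (k t)) (ap h p) :=
  ap2 h (ap_compose h k p) @ inverse (ap_compose k h (ap h p)).

Section HalfAdjointCoherence.
Context {A B : Type} (f : A -> B) (g : B -> A) (eta : forall a, g (f a) = a)
  (eps : forall b, f (g b) = b) (tau : forall a, ap f (eta a) = eps (f a)).

Definition ap_hnat_eta {x y : A} (p : x = y)
  : ap (fun t => f (g t)) (ap f p) @ ap f (eta y) = ap f (eta x) @ ap f p :=
  whiskerR (inverse (ap_compose_shift f g p)) (ap f (eta y))
  @ (inverse (ap_pp f _ _) @ (ap2 f (hnat_id (fun t => g (f t)) eta p) @ ap_pp f _ _)).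

Lemma hnat_tau {x y : A} (p : x = y) :
  ap_hnat_eta p @ whiskerR (tau x) (ap f p)
  = whiskerL (ap (fun t => f (g t)) (ap f p)) (tau y)
    @ hnat_id (fun t => f (g t)) eps (ap f p).
Proof.
  destruct p; cbn.
  assert (base : ap_hnat_eta (idpath x) = concat_1p (ap f (eta x))).
  { exact (concat_1p _ @ ap2_concat_1p f (eta x)). }
  rewrite base.
  exact (concat_1p_natural (tau x)).
Defined.

(* After whiskering with f[eta a], the tau-side is computed by the naturality
   of tau along eta a, and the eta-side cancels by the defining property of
   [coh_id]. *)
Lemma ap_coh_id_eta_tau (a : A) :
  ap2 f (coh_id (fun t => g (f t)) eta a)
  @ (ap_compose_shift f g (eta a) @ ap2 (fun t => f (g t)) (tau a))
  = tau (g (f a)) @ coh_id (fun t => f (g t)) eps (f a).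
Proof.
  apply (whiskerR_inj _ _ (ap f (eta a))).
  rewrite !whiskerR_pp.
  assert (eta_square :
    whiskerR (ap2 f (coh_id (fun t => g (f t)) eta a)) (ap f (eta a))
    @ (whiskerR (ap_compose_shift f g (eta a)) (ap f (eta a)) @ ap_hnat_eta (eta a))
    = idpath).
  { unfold ap_hnat_eta.
    rewrite whiskerR_V, concat_p_Vp, (hnat_id_coh_id (fun t => g (f t)) eta a).
    rewrite ap2_V, ap_whiskerR.
    exact (concat_conj_V _ _ _). }
  assert (tau_square :
    whiskerR (ap2 (fun t => f (g t)) (tau a)) (ap f (eta a))
    = ap_hnat_eta (eta a) @ (whiskerR (tau (g (f a))) (ap f (eta a))
                             @ whiskerR (coh_id (fun t => f (g t)) eps (f a)) (ap f (eta a)))).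
  { refine (whiskerR_ap2_hnat_id _ eps _ (tau a) @ _).
    refine (inverse (concat_pp_p _ _ _) @ _).
    refine (whiskerR (inverse (hnat_tau (eta a))) _ @ _).
    exact (concat_pp_p _ _ _). }
  rewrite tau_square.
  set (rest := whiskerR (tau (g (f a))) (ap f (eta a)) @ _).
  rewrite <- (concat_pp_p _ (ap_hnat_eta (eta a)) rest), <- concat_pp_p, eta_square.
  exact (concat_1p _).
Defined.

Lemma ap2_Coh_tau (a : A) :
  ap2 f (Coh f g eta a @ ap2 g (tau a)) = tau (g (f a)) @ Coh g f eps (f a).
Proof.
  change (Coh f g eta a)
    with (coh_id (fun t => g (f t)) eta a @ ap_compose f g (eta a)).
  change (Coh g f eps (f a))
    with (coh_id (fun t => f (g t)) eps (f a) @ ap_compose g f (eps (f a))).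
  rewrite !ap2_pp, ap2_compose, <- (concat_pp_p (tau (g (f a)))), <- ap_coh_id_eta_tau.
  unfold ap_compose_shift.
  rewrite !concat_pp_p.
  exact idpath.
Defined.
End HalfAdjointCoherence.

Record QEquiv (X Y : Type) := {
  qe_fun : X -> Y;
  qe_inv : Y -> X;
  qe_inv_fun : forall x, qe_inv (qe_fun x) = x;
  qe_fun_inv : forall y, qe_fun (qe_inv y) = y }.
Arguments Build_QEquiv {X Y}.
Arguments qe_fun {X Y}.
Arguments qe_inv {X Y}.
Arguments qe_inv_fun {X Y}.
Arguments qe_fun_inv {X Y}.

Definition qe_id (X : Type) : QEquiv X X :=
  Build_QEquiv (fun x => x) (fun x => x) (fun _ => idpath) (fun _ => idpath).

Definition qe_comp {X Y Z : Type} (e1 : QEquiv X Y) (e2 : QEquiv Y Z) : QEquiv X Z :=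
  Build_QEquiv (fun x => qe_fun e2 (qe_fun e1 x)) (fun z => qe_inv e1 (qe_inv e2 z))
    (fun x => ap (qe_inv e1) (qe_inv_fun e2 (qe_fun e1 x)) @ qe_inv_fun e1 x)
    (fun z => ap (qe_fun e2) (qe_fun_inv e1 (qe_inv e2 z)) @ qe_fun_inv e2 z).

Definition ishadj_adjointify {X Y : Type} (e : QEquiv X Y) : ishadj (qe_fun e).
Proof.
  destruct e as [h k s r]; cbn.
  exists k, s, (fun y => inverse (r (h (k y))) @ (ap h (s (k y)) @ r y)).
  intro x.
  rewrite (coh_id (fun t => k (h t)) s x), ap_compose_shift,
    (hnat_id (fun t => h (k t)) r (ap h (s x))).
  exact (inverse (concat_V_pp _ _)).
Defined.

Definition equiv_of_qe {X Y : Type} (e : QEquiv X Y) : Equiv X Y :=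
  existT _ (qe_fun e) (ishadj_adjointify e).

Definition ishadj_inj {X Y : Type} {h : X -> Y} (w : ishadj h) {x y : X} (e : h x = h y)
  : x = y :=
  inverse (projT1 (projT2 w) x) @ (ap (projT1 w) e @ projT1 (projT2 w) y).

Definition ishadj_ap {X Y : Type} (h : X -> Y) (w : ishadj h) (x y : X)
  : ishadj (@ap X Y h x y).
Proof.
  refine (ishadj_adjointify (Build_QEquiv (ap h) (ishadj_inj w) _ _));
    destruct w as [k [eta [eps tau]]]; unfold ishadj_inj; cbn.
  - intro p; destruct p; cbn.
    rewrite concat_1p; exact (concat_Vp _).
  - intro q.
    rewrite !ap_pp, ap_V, !tau, <- ap_compose,
      (hnat_id (fun t => h (k t)) eps q).
    exact (concat_V_pp _ _).
Defined.

Definition Contr (X : Type) : Type := { c : X & forall x, c = x }.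

Definition contr_retract {X Y : Type} (s : X -> Y) (r : Y -> X)
  (rs : forall x, r (s x) = x) (c : Contr Y) : Contr X :=
  existT _ (r (projT1 c)) (fun x => ap r (projT2 c (s x)) @ rs x).

Lemma path_hfiber {X Y : Type} (h : X -> Y) {y : Y} {x1 x2 : X} (q : x1 = x2)
  (p1 : h x1 = y) (p2 : h x2 = y) (e : p1 = ap h q @ p2) :
  existT (fun x => h x = y) x1 p1 = existT _ x2 p2.
Proof. destruct q, (e @ concat_1p p2); exact idpath. Defined.

Definition contr_hfiber {X Y : Type} (h : X -> Y) (w : ishadj h) (y : Y)
  : Contr { x : X & h x = y }.
Proof.
  destruct w as [k [eta [eps tau]]].
  exists (existT _ (k y) (eps y)).
  intros [x p]; destruct p.
  exact (path_hfiber h (eta x) (eps (h x)) idpath (inverse (tau x))).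
Defined.

Definition contr_hfiber' {X Y : Type} (h : X -> Y) (w : ishadj h) (y : Y)
  : Contr { x : X & y = h x }.
Proof.
  refine (contr_retract (fun u => existT _ (projT1 u) (inverse (projT2 u)))
            (fun u => existT _ (projT1 u) (inverse (projT2 u))) _ (contr_hfiber h w y)).
  intros [x p]; exact (ap (existT _ x) (inv_V p)).
Defined.

Definition transport {X : Type} (P : X -> Type) {x y : X} (p : x = y) (u : P x) : P y :=
  match p with idpath => u end.

Definition qe_sig_contr_base {X : Type} (P : X -> Type) (c : Contr X) (x0 : X)
  : QEquiv { x : X & P x } (P x0).
Proof.
  pose (k := fun x => inverse (projT2 c x) @ projT2 c x0 : x = x0).
  refine (Build_QEquiv (fun u => transport P (k (projT1 u)) (projT2 u))
            (fun p => existT P x0 p) _ _).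
  - intros [x u]; cbn. destruct (k x); exact idpath.
  - intro p; cbn. exact (ap (fun e => transport P e p) (concat_Vp (projT2 c x0))).
Defined.

Definition contr_sig {X : Type} (P : X -> Type) (c : Contr X) (cP : forall x, Contr (P x))
  : Contr { x : X & P x } :=
  let e := qe_sig_contr_base P c (projT1 c) in
  contr_retract (qe_fun e) (qe_inv e) (qe_inv_fun e) (cP (projT1 c)).

Definition qe_loops3 {X : Type} {x y z : X} (w : x = z) {p q : x = y} {r s : p = q}
  (e : r = s) : QEquiv (r = s) (idpath (idpath z) = idpath (idpath z)).
Proof. destruct e, r, p, w; exact (qe_id _). Defined.

Definition twoadj_over {A B : Type} (f : A -> B) (w : ishadj f) : Type :=
  match w with existT _ g (existT _ eta (existT _ eps tau)) =>
    { theta : forall b, eta (g b) = ap g (eps b) &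
      ((forall a, Coh f g eta a @ ap2 g (tau a) = theta (f a))
       * (forall b, tau (g b) @ Coh g f eps b = ap2 f (theta b)))%type }
  end.

Definition qe_twoadj_sig {A B : Type} (f : A -> B)
  : QEquiv (twoadj f) { w : ishadj f & twoadj_over f w }.
Proof.
  refine (Build_QEquiv
    (fun t => match t with existT _ g (existT _ eta (existT _ eps (existT _ tau c))) =>
       existT (twoadj_over f) (existT _ g (existT _ eta (existT _ eps tau))) c end)
    (fun u => match u with existT _ (existT _ g (existT _ eta (existT _ eps tau))) c =>
       existT _ g (existT _ eta (existT _ eps (existT _ tau c))) end) _ _).
  - intros [g [eta [eps [tau c]]]]; exact idpath.
  - intros [[g [eta [eps tau]]] c]; exact idpath.
Defined.

Section Funext.
Variable funext : Funext.

Definition path_forall {X : Type} {P : X -> Type} {h k : forall x, P x}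
  (H : forall x, h x = k x) : h = k :=
  projT1 (funext X P h k) H.

Definition contr_forall {X : Type} (P : X -> Type) (c : forall x, Contr (P x))
  : Contr (forall x, P x) :=
  existT _ (fun x => projT1 (c x)) (fun s => path_forall (fun x => projT2 (c x) (s x))).

Definition qe_forall {X : Type} (P Q : X -> Type) (e : forall x, QEquiv (P x) (Q x))
  : QEquiv (forall x, P x) (forall x, Q x) :=
  Build_QEquiv (fun s x => qe_fun (e x) (s x)) (fun s x => qe_inv (e x) (s x))
    (fun s => path_forall (fun x => qe_inv_fun (e x) (s x)))
    (fun s => path_forall (fun x => qe_fun_inv (e x) (s x))).

Definition contr_forall_sig {X : Type} (P : X -> Type) (Q : forall x, P x -> Type)
  (c : forall x, Contr { y : P x & Q x y })
  : Contr { h : forall x, P x & forall x, Q x (h x) } :=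
  contr_retract
    (fun (u : { h : forall x, P x & forall x, Q x (h x) }) x =>
       existT (Q x) (projT1 u x) (projT2 u x))
    (fun k => existT _ (fun x => projT1 (k x)) (fun x => projT2 (k x)))
    (fun u => match u with existT _ _ _ => idpath end)
    (contr_forall _ c).

Definition contr_ishadj {A B : Type} (f : A -> B) (hf : ishadj f) : Contr (ishadj f).
Proof.
  (* (g, eps) is a section of the fibres of f, (eta, tau) one of the fibres of f[-]. *)
  pose (Y := { u : { g : B -> A & forall b, f (g b) = b } &
               { eta : forall a, projT1 u (f a) = a &
                       forall a, ap f (eta a) = projT2 u (f a) } }).
  refine (contr_retract
    (fun w : ishadj f => match w with existT _ g (existT _ eta (existT _ eps tau)) =>
       existT _ (existT _ g eps) (existT _ eta tau) : Y end)
    (fun v : Y => match v with existT _ (existT _ g eps) (existT _ eta tau) =>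
       existT _ g (existT _ eta (existT _ eps tau)) end)
    (fun w => match w with existT _ _ (existT _ _ (existT _ _ _)) => idpath end) _).
  apply contr_sig.
  - exact (contr_forall_sig (fun _ => A) (fun b a => f a = b) (contr_hfiber f hf)).
  - intros [g eps].
    exact (contr_forall_sig (fun a => g (f a) = a) (fun a q => ap f q = eps (f a))
             (fun a => contr_hfiber (ap f) (ishadj_ap f hf _ _) _)).
Defined.

Definition qe_twoadj_over_loops {A B : Type} (f : A -> B) (g : B -> A)
  (eta : forall a, g (f a) = a) (eps : forall b, f (g b) = b)
  (tau : forall a, ap f (eta a) = eps (f a))
  : QEquiv (twoadj_over f (existT _ g (existT _ eta (existT _ eps tau))))
      (forall x : A, idpath (idpath x) = idpath (idpath x)).
Proof.
  pose (w := existT _ g (existT _ eta (existT _ eps tau)) : ishadj f).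
  pose (K := fun a => Coh f g eta a @ ap2 g (tau a)).
  pose (L := fun b => tau (g b) @ Coh g f eps b).
  pose (ap2f_ishadj :=
    fun b => ishadj_ap (ap f) (ishadj_ap f w _ _) (eta (g b)) (ap g (eps b))).
  pose (Theta := { theta : forall b, eta (g b) = ap g (eps b) &
                   forall b, L b = ap2 f (theta b) }).
  pose (contr_Theta := contr_forall_sig _ (fun b t => L b = ap2 f t)
                         (fun b => contr_hfiber' _ (ap2f_ishadj b) (L b)) : Contr Theta).
  refine (qe_comp (Y := { t : Theta & forall a, K a = projT1 t (f a) }) _
           (qe_comp (qe_sig_contr_base _ contr_Theta (projT1 contr_Theta)) _)).
  - refine (Build_QEquiv
      (fun u : twoadj_over f w => match u with existT _ theta (c1, c2) =>
         existT (fun t : Theta => forall a, K a = projT1 t (f a)) (existT _ theta c2) c1 end)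
      (fun v => match v with existT _ (existT _ theta c2) c1 => existT _ theta (c1, c2) end)
      _ _).
    + intros [theta [c1 c2]]; exact idpath.
    + intros [[theta c2] c1]; exact idpath.
  - apply qe_forall; intro a.
    apply (qe_loops3 (eta (g (f a)) @ eta a)).
    apply (ishadj_inj (ap2f_ishadj (f a))).
    exact (ap2_Coh_tau f g eta eps tau a @ projT2 (projT1 contr_Theta) (f a)).
Defined.

End Funext.

Theorem theorem3p13 (funext : Funext) (A B : Type) (f : A -> B)
  (hf : ishadj f) :
  Equiv (twoadj f) (forall x : A, (idpath (idpath x)) = (idpath (idpath x))).
Proof.
  apply equiv_of_qe.
  refine (qe_comp (qe_twoadj_sig f)
            (qe_comp (qe_sig_contr_base _ (contr_ishadj funext f hf) hf) _)).
  destruct hf as [g [eta [eps tau]]].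
  exact (qe_twoadj_over_loops funext f g eta eps tau).
Qed.
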